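(* Let $p$ be a prime, $n$ a positive integer, and $\alpha=\frac{p^n-1}{p-1}$. Then the characteristic polynomial of the distance matrix of the enhanced power graph of $\mathrm{El}(p^n)$ is \[ \phi_D(\mathcal{G}_E(\mathrm{El}(p^n)),x)=(x+p)^{\alpha-1}(x+1)^{(p-2)\alpha}\big(x^2-(2p^n-p-2)x-(p^n-1)\big). \] In particular, the eigenvalues of the distance matrix of the power graph $\mathcal{P}(\mathrm{El}(p^n))$ are $-1$ with multiplicity $(p-2)\alpha$, $-p$ with multiplicity $\alpha-1$, and the two simple eigenvalues $\lambda_{1,2}=\frac{(2p^n-p-2)\pm\sqrt{(2p^n-p-2)^2+4(p^n-1)}}{2}$.
   Context: $\mathrm{El}(p^n)$ denotes the elementary abelian group of order $p^n$. For a group $G$, the enhanced power graph $\mathcal{G}_E(G)$ is the simple graph with vertex set $G$ in which distinct $a,b$ are adjacent if and only if $a,b\in\langle c\rangle$ for some $c\in G$; the power graph $\mathcal{P}(G)$ is the simple graph with vertex set $G$ in which distinct $a,b$ are adjacent if and only if $a=b^k$ or $b=a^k$ for some positive integer $k$. The distance matrix of a connected graph has $(u,v)$-entry equal to the graph distance $d(u,v)$ (and $0$ on the diagonal), and $\phi_D(\Gamma,x)=\det(xI-D(\Gamma))$.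
   Formalization: For n = 1 one has λ2 = −1, so −1 does not have multiplicity exactly (p−2)α and λ2 is not simple for p ≥ 3; the eigenvalue list with repetition is proved for all n ≥ 1, and the exact multiplicities of −1 and λ2 only for n ≥ 2. *)

(* Defs.v *)
From mathcomp Require Import all_boot all_order all_algebra all_fingroup all_solvable.
From mathcomp Require Import boolp.

Set Implicit Arguments.
Unset Strict Implicit.
Unset Printing Implicit Defensive.

Import GRing.Theory.

Section GroupGraphs.
Variable gT : finGroupType.
Local Open Scope group_scope.

Definition enhanced_power_graph : rel gT := fun a b =>
  (a != b) && [exists c : gT, (a \in <[c]>) && (b \in <[c]>)].

Definition power_graph : rel gT := fun a b =>
  (a != b) && `[< exists k : nat, (0 < k)%N /\ (a = b ^+ k \/ b = a ^+ k) >].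

End GroupGraphs.

Arguments enhanced_power_graph : clear implicits.
Arguments power_graph : clear implicits.

Section Distance.
Variables (T : finType) (e : rel T).

Definition has_walk (u v : T) (k : nat) : bool :=
  [exists w : k.-tuple T, path e u w && (last u w == v)].

(* Least length of a walk from u to v. A shortest walk repeats no vertex, so
   lengths below #|T| suffice; the value is #|T| when v is unreachable. *)
Definition gdist (u v : T) : nat := find (has_walk u v) (iota 0 #|T|).

Lemma gdistP u v : connect e u v ->
  has_walk u v (gdist u v) /\ forall k, has_walk u v k -> gdist u v <= k.
Proof.
move=> /connectP[w0 w0P ->]; case: (shortenP w0P) => w wP wU _.
set v' := last u w.
have sz : size w < #|T|.
  by have := max_card (mem (u :: w)); rewrite (card_uniqP wU).
have hw : has_walk u v' (size w).
  by apply/existsP; exists (in_tuple w); rewrite /= wP eqxx.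
have hs : has (has_walk u v') (iota 0 #|T|).
  by apply/hasP; exists (size w); rewrite ?mem_iota.
have lt : gdist u v' < #|T| by move: hs; rewrite has_find size_iota.
split; first by have := nth_find 0 hs; rewrite nth_iota.
move=> k hk; rewrite leqNgt; apply/negP => kd.
by have := before_find 0 kd; rewrite nth_iota ?hk // (ltn_trans kd).
Qed.

Local Open Scope ring_scope.

Definition distance_mx (R : nzRingType) : 'M[R]_#|T| :=
  \matrix_(i, j) (gdist (enum_val i) (enum_val j))%:R.

End Distance.

Arguments distance_mx {T} e R.

Lemma enhanced_power_graph_connected (gT : finGroupType) (u v : gT) :
  connect (enhanced_power_graph gT) u v.
Proof.
have E a b : (a == 1%g) || (b == 1%g) -> connect (enhanced_power_graph gT) a b.
  move=> ab; case: (eqVneq a b) => [-> //|ne]; apply: connect1.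
  rewrite /enhanced_power_graph ne /=; apply/existsP.
  case/orP: ab => /eqP->; [exists b | exists a];
  by rewrite cycle_id group1.
by apply: (@connect_trans _ _ 1%g); apply: E; rewrite eqxx ?orbT.
Qed.

Lemma power_graph_connected (gT : finGroupType) (u v : gT) :
  connect (power_graph gT) u v.
Proof.
have E a b : (a == 1%g) || (b == 1%g) -> connect (power_graph gT) a b.
  move=> ab; case: (eqVneq a b) => [-> //|ne]; apply: connect1.
  rewrite /power_graph ne /=; apply/asboolP.
  case/orP: ab => /eqP->; [exists #[b]%g | exists #[a]%g];
  by rewrite expg_order order_gt0; split; auto.
by apply: (@connect_trans _ _ 1%g); apply: E; rewrite eqxx ?orbT.
Qed.

Section Spectrum.
Variables (F : fieldType) (m : nat).
Implicit Type A : 'M[F]_m.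
Local Open Scope ring_scope.

(* The eigenvalues of A, repeated according to multiplicity, are those of s. *)
Definition has_spectrum A (s : seq F) : Prop :=
  char_poly A = \prod_(z <- s) ('X - z%:P).

Definition multiplicity A (z : F) : nat := mup z (char_poly A).

End Spectrum.

(* Main.v *)
Require Import Defs.
From mathcomp Require Import all_boot all_order all_algebra all_fingroup all_solvable.
From mathcomp Require Import boolp.
From mathcomp Require Import zify ring lra.

(** Every nontrivial cyclic subgroup of El(p^n) has order p, so both graphs are
    the same windmill: the identity is joined to everything and the other
    vertices form alpha disjoint cliques of size p - 1. The matrix D + I is
    constant on pairs of classes, hence D + I = W K W^T for the class indicator
    matrix W, and the identity y^k det(y I_m - B C) = y^m det(y I_k - C B)
    reduces the characteristic polynomial to a determinant of size alpha + 1.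
    Applying the same identity once more leaves a 2 x 2 determinant, which gives
    the quadratic factor. *)

Set Implicit Arguments.
Unset Strict Implicit.
Unset Printing Implicit Defensive.

Import GRing.Theory Num.Theory.
Local Open Scope ring_scope.

(** * Determinants over a commutative ring *)

(** Column operations clear [C] in the block matrix with rows [(y, B)] and [(C, 1)] and leave the
    determinant of [y - B C]. Row operations clear it at the cost of a factor [y ^+ k], with no
    division by [y]. *)
Lemma det_scalar_mx_subM (A : comNzRingType) (m k : nat) (B : 'M[A]_(m, k))
    (C : 'M[A]_(k, m)) (y : A) :
  y ^+ k * \det (y%:M - B *m C) = y ^+ m * \det (y%:M - C *m B).
Proof.
pose M := block_mx y%:M B C 1%:M.
have detM : \det M = \det (y%:M - B *m C).
  have : M *m block_mx 1%:M 0 (- C) 1%:M = block_mx (y%:M - B *m C) B 0 1%:M.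
    by rewrite mulmx_block !mulmx1 !mulmx0 !add0r mulmxN mul1mx addrN.
  move/(congr1 determinant).
  by rewrite det_mulmx det_lblock det_ublock !det1 !mulr1.
have : block_mx 1%:M 0 (- C) y%:M *m M = block_mx y%:M B 0 (y%:M - C *m B).
  rewrite mulmx_block !mul1mx !mul0mx !addr0 mul_scalar_mx mul_mx_scalar mulmx1.
  by rewrite scalerN addNr mulNmx addrC.
move/(congr1 determinant).
by rewrite det_mulmx det_lblock det_ublock det1 mul1r !det_scalar detM.
Qed.

Lemma det_mx22 (A : comNzRingType) (M : 'M[A]_2) :
  \det M = M 0 0 * M 1 1 - M 0 1 * M 1 0.
Proof.
rewrite (expand_det_row _ 0) !big_ord_recl big_ord0 addr0 /cofactor !det_mx11.
rewrite !mxE /= !expr0 !mul1r expr1 mulN1r mulrN.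
by congr (_ * M _ _ - M _ _ * M _ _); apply: val_inj.
Qed.

Lemma sum_enum_val (V : nmodType) (T : finType) (F : T -> V) :
  \sum_(i < #|T|) F (enum_val i) = \sum_t F t.
Proof. by rewrite -big_enum_val. Qed.

(** * The quotient matrix of a windmill *)

Section WindmillMatrix.
Variables (A : comNzRingType) (S : finType) (s0 : S) (m : nat).

(* A windmill is a cone with apex [x0] over [k] disjoint cliques of size [m]; its
   vertices fall into the class [s0] = {x0} and the cliques. [windmill_coef s t]
   is the entry of D + I at vertices of classes [s] and [t]. *)
Definition windmill_coef (s t : S) : A :=
  if (s == s0) || (t == s0) then 1 else 2 - (s == t)%:R.

(* Each column is weighted by the size of its class. *)
Definition windmill_quotient : 'M[A]_#|S| :=
  \matrix_(i, j) (windmill_coef (enum_val i) (enum_val j)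
                  * (if enum_val j == s0 then 1 else m%:R)).

Lemma sum_windmill (a b : A) :
  \sum_(s : S) (if s == s0 then a else b) = a + b *+ #|S|.-1.
Proof.
rewrite (bigD1 s0) //= eqxx; congr (_ + _).
rewrite (eq_bigr (fun=> b)) => [|s /negPf-> //].
by rewrite sumr_const cardC1.
Qed.

(** The last factor is the characteristic polynomial at [z] of the 2 x 2 matrix with rows
    [(m + 1, m k)] and [(1, 2 m k)]. The factor [z ^+ 2] stays on the left because [A] does not
    allow cancelling it. *)
Lemma det_windmill_quotient (y : A) (z := y + m%:R) (k := #|S|.-1) :
  z ^+ 2 * \det (y%:M - windmill_quotient) =
  z ^+ #|S| * ((z - m.+1%:R) * (z - 2 * (m * k)%:R) - (m * k)%:R).
Proof.
(* After adding m I the rows only depend on whether the class is [s0], so the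
   determinant reduces further to a 2 x 2 one. *)
pose U : 'M[A]_(#|S|, 2) := \matrix_(i, j) ((enum_val i != s0) == j :> nat)%:R.
pose V : 'M[A]_(2, #|S|) := \matrix_(i, j)
  if i == ord0 then (if enum_val j == s0 then m.+1%:R else m%:R)
  else (if enum_val j == s0 then 1 else 2 * m%:R).
have -> : y%:M - windmill_quotient = z%:M - U *m V.
  apply/matrixP => i j; rewrite !mxE big_ord_recl big_ord1 !mxE /=.
  rewrite /windmill_coef -(inj_eq enum_val_inj i j).
  case: (eqVneq (enum_val i) s0) => [->|i0];
    case: (eqVneq (enum_val j) s0) => [j0|j0] /=;
    rewrite ?j0 ?eqxx ?[s0 == _]eq_sym ?(negPf i0) ?(negPf j0) /= /z -?natr1;
    rewrite ?mulr1n ?mulr0n; ring.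
rewrite det_scalar_mx_subM; congr (_ * _).
have VU (i j : 'I_2) : (V *m U) i j =
    \sum_(s : S) (if i == ord0 then (if s == s0 then m.+1%:R else m%:R)
      else (if s == s0 then 1 else 2 * m%:R)) * ((s != s0) == j :> nat)%:R.
  by rewrite -sum_enum_val mxE; apply: eq_bigr => l _; rewrite !mxE.
have E (a b : A) (j : nat) : \sum_(s : S) (if s == s0 then a else b)
    * ((s != s0) == j :> nat)%:R = a * (0%N == j)%:R + (b * (1%N == j)%:R) * k%:R.
  rewrite [_ * k%:R]mulr_natr -sum_windmill; apply: eq_bigr => s _.
  by case: eqP.
have ME (i j : 'I_2) : (z%:M - V *m U) i j = z *+ (i == j) - (V *m U) i j.
  by rewrite [LHS]mxE [z%:M i j]mxE [(- (V *m U)) i j]mxE.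
rewrite det_mx22 !ME !VU /= !E /= natrM -natr1.
rewrite ?mulr1n ?mulr0n /=; ring.
Qed.

End WindmillMatrix.

(** * Distances and characteristic polynomial of a windmill *)

Section WindmillGraph.
Variables (T S : finType) (e : rel T) (f : T -> S) (x0 : T).
Hypothesis eE : forall u v,
  e u v = (u != v) && [|| u == x0, v == x0 | f u == f v].

(** Every vertex is equal or adjacent to the apex [x0], so the diameter is at most 2. *)
Lemma gdist_windmill (u v : T) :
  gdist e u v = if u == v then 0%N
                else if [|| u == x0, v == x0 | f u == f v] then 1%N else 2%N.
Proof.
have walk1 a b : e a b -> has_walk e a b 1.
  by move=> ab; apply/existsP; exists [tuple b]; rewrite /= ab eqxx.
have C : connect e u v.
  have K a b : (a == x0) || (b == x0) -> connect e a b.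
    case: (eqVneq a b) => [-> //|ab] h; apply: connect1.
    by rewrite eE ab /=; case/orP: h => ->; rewrite ?orbT.
  by apply: (@connect_trans _ _ x0); apply: K; rewrite eqxx ?orbT.
have [W minW] := gdistP C.
have W0 : has_walk e u v 0 -> u = v.
  by case/existsP => w; rewrite (tuple0 w) => /eqP.
have W1 : has_walk e u v 1 -> e u v.
  case/existsP => w; case/tupleP: w => b w; rewrite (tuple0 w) /= andbT.
  by case/andP => ub /eqP <-.
case: (eqVneq u v) => [uv|uv].
  apply/eqP; rewrite -leqn0; apply: minW.
  by apply/existsP; exists [tuple]; rewrite /= uv.
have := eE u v; rewrite uv /=; case: ifP => h euv.
  have := minW 1%N (walk1 _ _ euv); move: W W0.
  by case: gdist => [|[|?]] // /[swap] h0 /h0 /eqP; rewrite (negPf uv).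
have W2 : has_walk e u v 2.
  move/norP: (negbT h) => [u0 /norP[v0 _]].
  apply/existsP; exists [tuple x0; v]; rewrite /= !eE u0 eqxx orbT /=.
  by rewrite eq_sym v0 eqxx.
have := minW _ W2; move: W W0 W1; case: gdist => [|[|[|?]]] //.
  by move=> /[swap] h0 /h0 /eqP; rewrite (negPf uv).
by move=> /[swap] _ /[swap] h1 /h1; rewrite euv.
Qed.

Variables (F : idomainType) (m k : nat).
Hypothesis f_x0 : forall u, f u = f x0 -> u = x0.
Hypothesis card_fiber : forall s, s != f x0 -> #|[set u | f u == s]| = m.
Hypothesis card_S : #|S| = k.+1.

Lemma card_windmill : #|T| = (1 + m * k)%N.
Proof.
rewrite -sum1_card (partition_big f predT) //= (bigD1 (f x0)) //=.
rewrite (bigD1 x0) //= big1 ?addn0; last first.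
  by move=> u /andP[/eqP/f_x0 ->]; rewrite eqxx.
congr (_ + _)%N; rewrite (eq_bigr (fun=> m)) => [|s /card_fiber <-].
  by rewrite sum_nat_const cardC1 card_S mulnC.
by rewrite sum1dep_card.
Qed.

(** The exponents are differences of matrix sizes: [#|T| - #|S| = (m - 1) k] for ['X + 1] and
    [#|S| - 2 = k - 1] for ['X + (m + 1)]. *)
Lemma char_poly_windmill :
  (0 < m)%N -> (0 < k)%N ->
  char_poly (distance_mx e F) =
    ('X + m.+1%:R%:P) ^+ (k - 1) * ('X + 1) ^+ ((m - 1) * k)
      * ('X * ('X + m.+1%:R%:P - 2 * (m * k)%:R%:P) - (m * k)%:R%:P).
Proof.
move=> m_gt0 k_gt0; rewrite !polyC_natr.
set y : {poly F} := 'X + 1.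
pose W : 'M[{poly F}]_(#|T|, #|S|) :=
  \matrix_(i, j) (f (enum_val i) == enum_val j)%:R.
pose K : 'M[{poly F}]_#|S| :=
  \matrix_(i, j) windmill_coef _ (f x0) (enum_val i) (enum_val j).
have sumW (u : T) (G : S -> {poly F}) :
    \sum_(j < #|S|) (f u == enum_val j)%:R * G (enum_val j) = G (f u).
  rewrite (sum_enum_val (fun s => (f u == s)%:R * G s)) (bigD1 (f u)) //= eqxx.
  rewrite mul1r big1 ?addr0 // => s /negPf; rewrite eq_sym => ->.
  by rewrite mul0r.
have WKW : char_poly_mx (distance_mx e F) = y%:M - W *m (K *m W^T).
  apply/matrixP => i j; rewrite !mxE.
  under eq_bigr => l _ do rewrite !mxE.
  under eq_bigr => l _.
    under eq_bigr => l' _ do rewrite !mxE mulrC.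
    rewrite (sumW _ (fun t => windmill_coef _ (f x0) (enum_val l) t)); over.
  rewrite (sumW _ (fun s => windmill_coef _ (f x0) s (f (enum_val j)))).
  rewrite gdist_windmill -(inj_eq enum_val_inj i j) polyC_natr /windmill_coef.
  set u := enum_val i; set v := enum_val j.
  have fx0 w : (f w == f x0) = (w == x0).
    by apply/eqP/eqP => [/f_x0|->].
  rewrite !fx0; case: (eqVneq u v) => [->|uv] /=.
    by rewrite orbb /y !eqxx; case: ifP => _; rewrite ?mulr1n ?mulr0n; ring.
  rewrite !mulr0n; case: eqP => //= _; case: eqP => //= _.
  by case: eqP => //= _; rewrite ?mulr1n ?mulr0n; ring.
have KWW : K *m W^T *m W = windmill_quotient _ (f x0) m.
  apply/matrixP => i j; rewrite -mulmxA !mxE.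
  (* [W^T W] is diagonal and its entries are the class sizes, which are the column weights of
     [windmill_quotient]. *)
  have WW l : (W^T *m W) l j = (l == j)%:R * (if enum_val j == f x0 then 1 else m%:R).
    rewrite mxE; under eq_bigr => t _ do rewrite !mxE.
    rewrite (sum_enum_val (fun t => (f t == enum_val l)%:R * (f t == enum_val j)%:R)).
    case: (eqVneq l j) => [->|lj]; last first.
      rewrite mul0r big1 // => t _; case: eqP => [->|]; last by rewrite mul0r.
      by rewrite (inj_eq enum_val_inj) (negPf lj) mulr0.
    rewrite mul1r (eq_bigr (fun t => (f t == enum_val j)%:R)); last first.
      by move=> t _; case: (_ == _); rewrite ?mulr1 ?mulr0.
    rewrite -natr_sum -big_mkcond /= sum1dep_card; case: eqP => [-> |/eqP/card_fiber->//].
    rewrite (_ : [set _ | _] = [set x0]) ?cards1 //.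
    by apply/setP => u; rewrite !inE; apply/eqP/eqP => [/f_x0|->].
  rewrite (bigD1 j) //= WW eqxx mul1r big1 ?addr0; last first.
    by move=> l /negPf lj; rewrite WW lj mul0r mulr0.
  by rewrite !mxE.
have := det_scalar_mx_subM W (K *m W^T) y.
have := det_windmill_quotient (f x0) m y.
rewrite -WKW KWW -/(char_poly _) /=.
move: (char_poly _) (\det _) => c d.
rewrite card_windmill card_S /=.
have -> : y + m%:R = 'X + m.+1%:R by rewrite /y -natr1; ring.
set z := 'X + m.+1%:R => Hz Hy.
(* Both are monic of degree 1, so their powers cancel in polynomials over an integral domain. *)
have y0 : y != 0 by rewrite -size_poly_eq0 /y -polyC1 size_XaddC.
have z0 : z != 0 by rewrite -size_poly_eq0 /z -polyC_natr size_XaddC.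
apply: (mulfI (expf_neq0 k.+1 y0)); rewrite Hy.
apply: (mulfI (expf_neq0 2 z0)); rewrite mulrCA Hz.
have -> : (1 + m * k = k.+1 + (m - 1) * k)%N by nia.
have -> : k.+1 = (2 + (k - 1))%N by lia.
rewrite !exprD /z; ring.
Qed.

End WindmillGraph.

(** * Both graphs of an elementary abelian group are windmills *)

Section ElementaryAbelian.
Variables (p n : nat) (gT : finGroupType).
Hypotheses (p_prime : prime p) (n_gt0 : (0 < n)%N).
Hypotheses (abelem_gT : (p.-abelem [set: gT])%g) (card_gT : #|gT| = (p ^ n)%N).

Local Notation cyclic_adj u v :=
  ((u != v) && [|| u == 1%g, v == 1%g | <[u]>%g == <[v]>%g]).

(** Both cyclic groups have order [p], and one contains the other. *)
Lemma abelem_cycle_eq (x c : gT) : (x \in <[c]>)%g -> x != 1%g -> <[x]>%g = <[c]>%g.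
Proof.
move=> xc x1; have c1 : c != 1%g.
  by apply: contraNneq x1 => c1; move: xc; rewrite c1 cycle1 inE.
apply/eqP; rewrite eqEcard cycle_subG xc -!orderE.
by rewrite !(abelem_order_p abelem_gT) ?inE /=.
Qed.

Lemma enhanced_power_graphE (u v : gT) :
  enhanced_power_graph gT u v = cyclic_adj u v.
Proof.
rewrite /enhanced_power_graph; congr (_ && _); apply/existsP/idP.
  case=> c /andP[uc vc]; case: eqVneq => //= u1; case: eqVneq => //= v1.
  by rewrite (abelem_cycle_eq uc u1) (abelem_cycle_eq vc v1).
case/or3P => /eqP E; [exists v | exists u | exists u].
- by rewrite E group1 cycle_id.
- by rewrite E group1 cycle_id.
- by rewrite {2}E !cycle_id.
Qed.

Lemma power_graphE (u v : gT) : power_graph gT u v = cyclic_adj u v.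
Proof.
rewrite /power_graph; congr (_ && _); apply/asboolP/idP.
  case=> k [_ [E|E]].
    have uv : (u \in <[v]>)%g by rewrite E mem_cycle.
    by case: eqVneq => //= u1; rewrite (abelem_cycle_eq uv u1) eqxx orbT.
  have vu : (v \in <[u]>)%g by rewrite E mem_cycle.
  case: (eqVneq v 1%g) => [|v1]; first by rewrite orbT.
  by rewrite (abelem_cycle_eq vu v1) eqxx !orbT.
case/or3P => /eqP E.
- by exists #[v]%g; rewrite E expg_order; split; auto.
- by exists #[u]%g; rewrite E expg_order; split; auto.
have /cycleP[i ui] : (u \in <[v]>)%g by rewrite -E cycle_id.
(* The exponent [i] may be 0; adding the order of [v] makes it positive without changing the
   power. *)
exists (i + #[v]%g)%N; rewrite addn_gt0 order_gt0 orbT expgD expg_order mulg1.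
by split; auto.
Qed.

(** Stated for an arbitrary relation [e] so that it serves both graphs. *)
Lemma char_poly_abelem_distance (F : idomainType) (e : rel gT)
    (alpha := ((p ^ n - 1) %/ (p - 1))%N) :
  (forall u v, e u v = cyclic_adj u v) ->
  char_poly (distance_mx e F) =
    ('X + p%:R%:P) ^+ (alpha - 1) * ('X + 1) ^+ ((p - 2) * alpha)
      * ('X^2 - (2 * p%:R ^+ n - p%:R - 2) *: 'X - (p%:R ^+ n - 1)%:P).
Proof.
move=> eE; have p_gt1 := prime_gt1 p_prime.
(* The classes are the cyclic subgroups, and [f] sends an element to the one it generates. The fiber
   of a nontrivial subgroup consists of its [p - 1] generators. *)
pose P : {set {set gT}} := [set <[x]>%g | x : gT].
have fP x : <[x]>%g \in P by apply: imset_f.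
pose f (x : gT) : {C | C \in P} := exist _ <[x]>%g (fP x).
have fE u v : (f u == f v) = (<[u]>%g == <[v]>%g) by [].
have f1 u : f u = f 1%g -> u = 1%g.
  by move/eqP; rewrite fE cycle1 cycle_eq1 => /eqP.
have fiber s : s != f 1%g -> #|[set u | f u == s]| = (p - 1)%N.
  case: s => C CP; have /imsetP[x _ Cx] := CP.
  have -> : exist _ C CP = f x by apply: val_inj.
  rewrite fE cycle1 cycle_eq1 => x1.
  have -> : [set u | f u == f x] = (<[x]> :\ 1)%g.
    apply/setP => u; rewrite !inE fE; apply/eqP/andP => [ux|[u1 ux]].
      by rewrite -cycle_eq1 ux cycle_eq1 -ux cycle_id.
    exact: abelem_cycle_eq.
  have := cardsD1 1%g <[x]>%g; rewrite group1 -orderE.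
  by rewrite (abelem_order_p abelem_gT) ?inE // => ->; rewrite addKn.
have [k card_S] : exists k, #|{: {C | C \in P}}| = k.+1.
  exists #|{: {C | C \in P}}|.-1; rewrite prednK //.
  by apply/card_gt0P; exists (f 1%g).
(* Counting the vertices class by class identifies [k] with [alpha]. *)
have pn : (p ^ n = 1 + (p - 1) * k)%N.
  by rewrite -card_gT; exact: card_windmill f1 fiber card_S.
have alphaE : alpha = k.
  by rewrite /alpha pn addKn mulKn // subn_gt0.
have k_gt0 : (0 < k)%N.
  by case: (k) pn (ltn_expl n p_gt1) => // ->; rewrite muln0 ltnS leqn0 gtn_eqF.
rewrite (char_poly_windmill (f := f) eE _ f1 fiber card_S) ?subn_gt0 //.
rewrite alphaE; congr (_ * _).
  by congr (_ ^+ _ * _ ^+ _); [congr ('X + _%:R%:P); lia | lia].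
have -> : (p%:R ^+ n : F) = 1 + (p - 1)%:R * k%:R.
  by rewrite -natrX pn natrD natrM.
have pE : (p%:R : F) = (p - 1)%:R + 1 by rewrite natr1; congr (_%:R); lia.
rewrite pE -natr1 natrM -mul_polyC !rmorphE /=; ring.
Qed.

End ElementaryAbelian.

(** * Factorization of the quadratic and multiplicities *)

(** For [n = 1] the quadratic is [(x - (p - 1)) (x + 1)], so [lambda2] equals -1; hence the
    assumption [1 < n] on these two multiplicities. *)
Theorem theorem5p2 (R : rcfType) (p n : nat) (gT : finGroupType)
    (p_prime : prime p) (n_gt0 : (0 < n)%N)
    (abelem_gT : (p.-abelem [set: gT])%g) (card_gT : #|gT| = (p ^ n)%N) :
  let alpha : nat := ((p ^ n - 1) %/ (p - 1))%N in
  let b : R := 2 * p%:R ^+ n - p%:R - 2 in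
  let c : R := p%:R ^+ n - 1 in
  let lambda1 : R := (b + Num.sqrt (b ^+ 2 + 4 * c)) / 2 in
  let lambda2 : R := (b - Num.sqrt (b ^+ 2 + 4 * c)) / 2 in
  let DE : 'M[R]_#|gT| := distance_mx (enhanced_power_graph gT) R in
  let DP : 'M[R]_#|gT| := distance_mx (power_graph gT) R in
  char_poly DE =
    ('X + p%:R%:P) ^+ (alpha - 1) * ('X + 1) ^+ ((p - 2) * alpha)
      * ('X^2 - b *: 'X - c%:P)
  /\ [/\ has_spectrum DP (nseq ((p - 2) * alpha) (-1)
                          ++ nseq (alpha - 1) (- p%:R)
                          ++ [:: lambda1; lambda2]),
         multiplicity DP (- p%:R) = (alpha - 1)%N,
         multiplicity DP lambda1 = 1%N
       & (1 < n)%N -> multiplicity DP (-1) = ((p - 2) * alpha)%N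
                      /\ multiplicity DP lambda2 = 1%N].
Proof.
move=> alpha b c lambda1 lambda2 DE DP.
have chE := char_poly_abelem_distance p_prime n_gt0 abelem_gT card_gT R
  (enhanced_power_graphE abelem_gT).
have chP := char_poly_abelem_distance p_prime n_gt0 abelem_gT card_gT R
  (power_graphE abelem_gT).
split; first exact: chE.
have p_gt1 : 1 < p%:R :> R by rewrite ltr1n prime_gt1.
have c_gt0 : 0 < c by rewrite subr_gt0 exprn_egt1 // -lt0n.
set s := Num.sqrt (b ^+ 2 + 4 * c) in lambda1 lambda2 *.
have disc_ge0 : 0 <= b ^+ 2 + 4 * c by have := sqr_ge0 b; lra.
have s_ge0 : 0 <= s by apply: sqrtr_ge0.
have s_sq : s ^+ 2 = b ^+ 2 + 4 * c by apply: sqr_sqrtr.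
have sumE : lambda1 + lambda2 = b by rewrite /lambda1 /lambda2; field.
have prodE : lambda1 * lambda2 = - c.
  have -> : lambda1 * lambda2 = (b ^+ 2 - s ^+ 2) / 4.
    by rewrite /lambda1 /lambda2; field.
  by rewrite s_sq; field.
have diffE : lambda1 - lambda2 = s by rewrite /lambda1 /lambda2; field.
have bE : b = 2 * c - p%:R by rewrite /b /c; ring.
have spec : has_spectrum DP (nseq ((p - 2) * alpha) (-1)
    ++ nseq (alpha - 1) (- p%:R) ++ [:: lambda1; lambda2]).
  rewrite /has_spectrum chP -/alpha -/b -/c !big_cat !big_nseq /=.
  rewrite !iter_mulr_1 !big_cons big_nil !polyCN !opprK polyC1.
  rewrite -sumE -[c]opprK -prodE -mul_polyC !rmorphE /=; ring.
(* From here on only the sum, product and difference of the roots matter: the product [- c] is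
   negative and the difference [s] is nonnegative, which gives the signs. *)
clearbody lambda1 lambda2 s b.
have l1_gt0 : 0 < lambda1 by nra.
have l2_lt0 : lambda2 < 0 by nra.
have Np1 : (-1 == - p%:R :> R) = false by apply/eqP; lra.
have l1p : (- p%:R == lambda1) = false by apply/eqP; lra.
(* If [lambda2] were [- p], the sum would force [lambda1 = 2 c], and the product would give
   [c (2 p - 1) = 0]. *)
have l2p : (- p%:R == lambda2) = false.
  apply/eqP => E; have l1E : lambda1 = 2 * c by lra.
  have : 0 < c * (2 * p%:R - 1) by rewrite mulr_gt0 //; lra.
  by move: prodE; rewrite l1E -E; lra.
have l11 : (-1 == lambda1) = false by apply/eqP; lra.
have l12 : (lambda1 == lambda2) = false by apply/eqP; lra.
(* Multiplicity is the number of occurrences in the list, so only coincidences among the four values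
   matter. *)
have mulE z : multiplicity DP z = ((-1 == z)%R * ((p - 2) * alpha)
    + ((- p%:R == z)%R * (alpha - 1) + ((lambda1 == z) + (lambda2 == z))))%N.
  by rewrite /multiplicity spec mu_prod_XsubC !count_cat !count_nseq /= addn0.
split=> //.
- by rewrite mulE Np1 eqxx ![_ == - _]eq_sym l1p l2p mul1n !addn0.
- by rewrite mulE l11 l1p eqxx eq_sym l12.
(* If [lambda2] were -1, the product would give [lambda1 = c], and the sum [c = p - 1], that is
   [p ^ n = p]. *)
move=> n_gt1; have l21 : (-1 == lambda2) = false.
  apply/eqP => E; have : p%:R ^+ n != p%:R :> R.
    rewrite -natrX eqr_nat -[X in _ != X]expn1 eqn_exp2l ?prime_gt1 //.
    by rewrite gtn_eqF.
  by move/eqP; apply; move: sumE prodE; rewrite -E bE /c; lra.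
split; last by rewrite mulE l21 l2p l12 eqxx.
rewrite mulE eqxx [- p%:R == _]eq_sym Np1 [lambda1 == _]eq_sym l11.
by rewrite [lambda2 == _]eq_sym l21 mul1n !addn0.
Qed.
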